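(* Let $f:\mathbb{R}^n\to\mathbb{R}$ be convex and twice differentiable, with finite infimum $f_*$ and $L_2$-Lipschitz Hessian. Let $x_0\in\mathbb{R}^n$, and assume that the sublevel set $L=\{x: f(x)<f(x_0)\}$ satisfies $D:=\sup\{\|x-x_*\| : x\in L\}<\infty$, where $x_*$ is a global minimizer of $f$, and that $\|\nabla f(x)\|\le G$ for all $x\in L$. Let $\rho:\mathbb{R}^n\to\mathbb{R}$ be $\sigma_V$-strongly convex with $L_V$-Lipschitz gradient and $2\sigma_V>L_V$. Fix $\eta>0$ and $0<\xi\le\frac{\sqrt5-1}{2}$, and let $(x_k)$ be generated by the algorithm HAT from $x_0$ with matrices $H_k$ and with $r_k$ and $A_k$ given by the parameter choice of HAT (see context). Assume that $H_k\succcurlyeq(L_V-\sigma_V)A_k I$ for every $k$, and that the relative inexactness $$\Delta=\sup_k \frac{\|\nabla^2 f(x_k)-H_k\|}{\|\nabla f(x_k)\|^{1/2}}$$ is finite. Then HAT needs $\mathcal{O}\left(\varepsilon^{-1/2}+\log\frac1\varepsilon\right)$ iterations to reach an $\varepsilon$-approximate zero-order stationary point. That is, there is a constant $C>0$, not depending on $\varepsilon$, such that for every $\varepsilon\in(0,1/2]$ there is an index $k\le C\left(\varepsilon^{-1/2}+\log\frac1\varepsilon\right)$ with $f(x_k)-f_*\le\varepsilon$.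
   Context: $\|\cdot\|$ is the Euclidean norm on vectors and the induced operator norm on matrices. $L_2$-Lipschitz Hessian: $\|\nabla^2 f(x)-\nabla^2 f(y)\|\le L_2\|x-y\|$ for all $x,y$. The scaling function $\rho$ is differentiable and satisfies $\rho(y)\ge\rho(x)+\langle\nabla\rho(x),y-x\rangle+\frac{\sigma_V}{2}\|y-x\|^2$ and $\|\nabla\rho(y)-\nabla\rho(x)\|\le L_V\|y-x\|$ for all $x,y$. The Bregman divergence is $V(x,y)=\rho(y)-\rho(x)-\langle\nabla\rho(x),y-x\rangle$. Algorithm HAT. At iteration $k=0,1,\dots$, given $x_k$ with $\nabla f(x_k)\neq0$ (if $\nabla f(x_k)=0$ the method stops), a symmetric matrix $H_k\in\mathbb{R}^{n\times n}$ (an approximation of $\nabla^2 f(x_k)$) and numbers $r_k,A_k$ are chosen; $d_k$ is a global solution of $$\min_{d\in\mathbb{R}^n}\ \langle\nabla f(x_k),d\rangle+\tfrac12\langle H_kd,d\rangle+A_kV(x_k,x_k+d)\quad\text{s.t.}\quad \|d\|^2\le r_k^2\|\nabla f(x_k)\|;$$ and $x_{k+1}=x_k+d_k$. Parameter choice of HAT (with hyperparameters $\eta>0$, $0<\xi<1$): $$r_k=\xi\left(\frac{\|\nabla^2 f(x_k)-H_k\|}{\|\nabla f(x_k)\|^{1/2}}\left(1+\frac{L_V}{2\sigma_V-L_V}\right)+\sqrt{\xi\left(\frac{L_2}{2}+L_V\frac{2\eta+L_2/3}{2\sigma_V-L_V}\right)}\right)^{-1},$$ $$A_k=\frac{\|\nabla^2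 f(x_k)-H_k\|}{2\sigma_V-L_V}+\frac{r_k\|\nabla f(x_k)\|^{1/2}}{2\sigma_V-L_V}\left(2\eta+\frac{L_2}{3}\right).$$ The supremum defining $\Delta$ is over the iterations $k$ performed (those with $\nabla f(x_k)\ne0$). *)

(* Defs.v *)
From HB Require Import structures.
From mathcomp Require Import all_boot all_order all_algebra.
From mathcomp Require Import all_classical all_reals all_analysis.

Set Implicit Arguments.
Unset Strict Implicit.
Unset Printing Implicit Defensive.

Import Order.TTheory GRing.Theory Num.Theory.
Import numFieldNormedType.Exports.

Local Open Scope classical_set_scope.
Local Open Scope ring_scope.

(* R^n is ['rV[R]_n]: a matrix [M] acts on a vector [v] as [v *m M].  The norm
   carried by ['rV[R]_n] in MathComp-Analysis is the sup norm; it only serves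
   to define differentiability, which does not depend on the norm here.  All
   quantitative statements use the Euclidean norm [enorm] below. *)

Section euclidean.
Context {R : realType} {n : nat}.
Implicit Types (u v x : 'rV[R]_n) (M : 'M[R]_n) (f : 'rV[R]_n -> R).

Definition dotp u v : R := \sum_(i < n) u 0 i * v 0 i.

Definition enorm v : R := Num.sqrt (dotp v v).

Definition opnorm M : R := sup [set enorm (v *m M) | v in [set v | enorm v <= 1]].

(* The Loewner order [N <= M], used for symmetric matrices. *)
Definition loewner_le (N M : 'M[R]_n) : Prop :=
  forall v, 0 <= dotp (v *m (M - N)) v.

Definition grad f x : 'rV[R]_n := \row_(i < n) 'D_(delta_mx 0 i) f x.

Definition hess f x : 'M[R]_n := jacobian (grad f) x.

Definition twice_differentiable f : Prop :=
  (forall x, differentiable f x) /\ (forall x, differentiable (grad f) x).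

Definition lipschitz_hessian (L2 : R) f : Prop :=
  forall x y, opnorm (hess f x - hess f y) <= L2 * enorm (x - y).

Definition lipschitz_gradient (LV : R) f : Prop :=
  forall x y, enorm (grad f y - grad f x) <= LV * enorm (y - x).

Definition strongly_convex (sV : R) f : Prop :=
  forall x y,
    f x + dotp (grad f x) (y - x) + sV / 2 * enorm (y - x) ^+ 2 <= f y.

Definition bregman (rho : 'rV[R]_n -> R) x y : R :=
  rho y - rho x - dotp (grad rho x) (y - x).

Definition sublevel f x0 : set 'rV[R]_n := [set x | f x < f x0].

End euclidean.

Section HAT.
Context {R : realType} {n : nat}.
Variables (f rho : 'rV[R]_n -> R).
Implicit Types (x d : nat -> 'rV[R]_n) (H : nat -> 'M[R]_n) (r A : nat -> R).

Definition HAT_model (xk : 'rV[R]_n) (Hk : 'M[R]_n) (Ak : R) (v : 'rV[R]_n) : R :=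
  dotp (grad f xk) v + 2^-1 * dotp (v *m Hk) v + Ak * bregman rho xk (xk + v).

Definition HAT_feasible (xk : 'rV[R]_n) (rk : R) : set 'rV[R]_n :=
  [set v | enorm v ^+ 2 <= rk ^+ 2 * enorm (grad f xk)].

Definition HAT_subproblem_solution (xk : 'rV[R]_n) (Hk : 'M[R]_n) (rk Ak : R)
    (dk : 'rV[R]_n) : Prop :=
  HAT_feasible xk rk dk /\
  forall v, HAT_feasible xk rk v -> HAT_model xk Hk Ak dk <= HAT_model xk Hk Ak v.

(* A run is encoded by total sequences, of which only the part up to the first
   stationary iterate is meaningful: [x k] is an iterate of the method when
   [HAT_reached x k], and iteration [k], which builds [x k.+1] from [x k], takes
   place when [HAT_performed x k].  Nothing is required of the rest. *)
Definition HAT_reached x (k : nat) : Prop :=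
  forall j, (j < k)%N -> grad f (x j) != 0.

Definition HAT_performed x (k : nat) : Prop :=
  forall j, (j <= k)%N -> grad f (x j) != 0.

Definition HAT_run (x0 : 'rV[R]_n) x d H r A : Prop :=
  x 0%N = x0 /\
  forall k, HAT_performed x k ->
    [/\ (H k)^T = H k,
        HAT_subproblem_solution (x k) (H k) (r k) (A k) (d k)
      & x k.+1 = x k + d k].

Definition HAT_radius (L2 sV LV eta xi : R) (xk : 'rV[R]_n) (Hk : 'M[R]_n) : R :=
  xi * (opnorm (hess f xk - Hk) / Num.sqrt (enorm (grad f xk))
          * (1 + LV / (2 * sV - LV))
        + Num.sqrt (xi * (L2 / 2
            + LV * ((2 * eta + L2 / 3) / (2 * sV - LV)))))^-1.

Definition HAT_weight (L2 sV LV eta : R) (xk : 'rV[R]_n) (Hk : 'M[R]_n)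
    (rk : R) : R :=
  opnorm (hess f xk - Hk) / (2 * sV - LV)
  + rk * Num.sqrt (enorm (grad f xk)) / (2 * sV - LV) * (2 * eta + L2 / 3).

Definition HAT_parameters (L2 sV LV eta xi : R) x H r A : Prop :=
  forall k, HAT_performed x k ->
    r k = HAT_radius L2 sV LV eta xi (x k) (H k) /\
    A k = HAT_weight L2 sV LV eta (x k) (H k) (r k).

Definition relative_inexactness x H : \bar R :=
  ereal_sup [set (opnorm (hess f (x k) - H k)
                    / Num.sqrt (enorm (grad f (x k))))%:E
            | k in [set k | HAT_performed x k]].

End HAT.

(* Main.v *)
Require Import Defs.
From HB Require Import structures.
From mathcomp Require Import all_boot all_order all_algebra.
From mathcomp Require Import all_classical all_reals all_analysis.
From mathcomp Require Import ring lra zify.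

Set Implicit Arguments.
Unset Strict Implicit.
Unset Printing Implicit Defensive.

Import Order.TTheory GRing.Theory Num.Theory.
Import numFieldNormedType.Exports.

Local Open Scope classical_set_scope.
Local Open Scope ring_scope.

(** Write [g_k] for the gradient at [x_k] and [phi_k = f (x_k) - f xstar].  The
    step [d] minimises a convex model over the ball of radius
    [rad = r sqrt |g_k|].  Let [p] be the gradient of the model at [d].  Testing
    the variational inequality of this constrained minimum at the point of the
    ball opposite to [p] gives [rad |p| <= - <p, d>]
    ([ball_variational_inequality]).  This single inequality plays the part of
    the multiplier of the ball constraint: [<p, d> <= 0], [|p| <= |g_k|], and
    [p = 0] as soon as [d] is interior.

    [HAT_step] feeds it into the two Taylor estimates [taylor_value] and
    [taylor_grad].  The weight [A] is such that the curvature
    [(2 sV - LV) A] pays for the Hessian error [delta] and for the cubic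
    remainder, which leaves the decrease [eta rad |d|^2] of [f].  The radius is
    such that everything but [p] in the new gradient amounts to at most
    [xi |g_k|] ([radius_contraction]), so [|g_(k+1)| <= |p| + xi |g_k|].  Hence
    there are two kinds of steps:
    - on the sphere, [f] decreases by [eta r^3 |g_k|^(3/2)], which is at least
      [c phi_k^(3/2)] because convexity gives [phi_k <= D |g_k|] and the finite
      inexactness keeps [r] away from 0; the gradient may grow, but by a factor
      [1 + xi] at most;
    - in the interior, [f] does not increase and the gradient shrinks by the
      factor [xi].

    The two kinds may alternate in any order.  After [a] steps of the first kind
    and [b] of the second, [sqrt phi <= 2 / (c a)] and
    [|g| <= (1 + xi)^a xi^b |g_0|] ([mixed_step_count]).  Since
    [xi (1 + xi) <= 1] for [xi <= (sqrt 5 - 1) / 2], each interior step undoes a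
    sphere step, so that [|g| <= xi^(b - a) |g_0|].  Among [N] steps either
    [a >= N / 3] or [b - a >= N / 3]: the first case produces the term
    [eps^(-1/2)] and the second one the logarithm ([mixed_step_complexity]).  A
    run that meets a stationary point earlier has reached a minimum, by
    convexity. *)

(** * Euclidean space *)

Lemma eq_ler (R : numDomainType) (a b : R) : a = b -> a <= b.
Proof. by move=> ->. Qed.

Section Euclidean.
Context {R : realType} {n : nat}.
Implicit Types (u v w x y : 'rV[R]_n) (M N : 'M[R]_n) (a b : R).

Lemma dotpC u v : dotp u v = dotp v u.
Proof. by apply: eq_bigr => i _; rewrite mulrC. Qed.

Lemma dotpDl u v w : dotp (u + v) w = dotp u w + dotp v w.
Proof. by rewrite -big_split; apply: eq_bigr => i _; rewrite mxE mulrDl. Qed.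

Lemma dotpZl a u v : dotp (a *: u) v = a * dotp u v.
Proof. by rewrite mulr_sumr; apply: eq_bigr => i _; rewrite mxE mulrA. Qed.

Lemma dotpNl u v : dotp (- u) v = - dotp u v.
Proof. by rewrite -scaleN1r dotpZl mulN1r. Qed.

Lemma dotpDr u v w : dotp w (u + v) = dotp w u + dotp w v.
Proof. by rewrite dotpC dotpDl !(dotpC w). Qed.

Lemma dotpZr a u v : dotp u (a *: v) = a * dotp u v.
Proof. by rewrite dotpC dotpZl (dotpC u). Qed.

Lemma dotpNr u v : dotp u (- v) = - dotp u v.
Proof. by rewrite dotpC dotpNl (dotpC u). Qed.

Definition dotp_lin := (dotpDl, dotpDr, dotpNl, dotpNr, dotpZl, dotpZr).

Lemma dot0p v : dotp 0 v = 0.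
Proof. by rewrite -(scale0r 0) dotpZl mul0r. Qed.

Lemma dotp0 v : dotp v 0 = 0.
Proof. by rewrite dotpC dot0p. Qed.

Lemma dotp_ge0 v : 0 <= dotp v v.
Proof. by apply: sumr_ge0 => i _; rewrite -expr2 sqr_ge0. Qed.

Lemma enorm_ge0 v : 0 <= enorm v.
Proof. exact: sqrtr_ge0. Qed.

Lemma sqr_enorm v : enorm v ^+ 2 = dotp v v.
Proof. by rewrite sqr_sqrtr// dotp_ge0. Qed.

Lemma enorm_eq0 v : (enorm v == 0) = (v == 0).
Proof.
apply/idP/eqP => [/eqP v0|->]; last first.
  by rewrite /enorm /dotp big1 ?sqrtr0// => i _; rewrite mxE mul0r.
have : dotp v v = 0 by rewrite -sqr_enorm v0 expr0n.
move/psumr_eq0P => v_eq0; apply/rowP => i; rewrite mxE; apply/eqP.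
by rewrite -sqrf_eq0 expr2 v_eq0// => j _; rewrite -expr2 sqr_ge0.
Qed.

Lemma enorm_gt0 v : (0 < enorm v) = (v != 0).
Proof. by rewrite lt_def enorm_eq0 enorm_ge0 andbT. Qed.

Lemma enorm0 : enorm (0 : 'rV[R]_n) = 0.
Proof. by apply/eqP; rewrite enorm_eq0. Qed.

(** For nonzero vectors, the square of [enorm v *: u - enorm u *: v] is
    [2 |u| |v| (|u| |v| - <u, v>)]. *)
Lemma cauchy_schwarz u v : dotp u v <= enorm u * enorm v.
Proof.
have [->|u0] := eqVneq u 0.
  by rewrite dot0p mulr_ge0 ?enorm_ge0.
have [->|v0] := eqVneq v 0.
  by rewrite dotp0 mulr_ge0 ?enorm_ge0.
have uv_gt0 : 0 < enorm u * enorm v by rewrite mulr_gt0 ?enorm_gt0.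
have := dotp_ge0 (enorm v *: u - enorm u *: v).
rewrite !dotp_lin (dotpC v u) -!sqr_enorm => uv_ge0.
by rewrite -(ler_pM2l uv_gt0); lra.
Qed.

Lemma enormZ a v : enorm (a *: v) = `|a| * enorm v.
Proof.
by rewrite /enorm !dotp_lin mulrA -expr2 sqrtrM ?sqr_ge0// sqrtr_sqr.
Qed.

Lemma enormN v : enorm (- v) = enorm v.
Proof. by rewrite -scaleN1r enormZ normrN1 mul1r. Qed.

Lemma cauchy_schwarzN u v : - (enorm u * enorm v) <= dotp u v.
Proof. by rewrite lerNl -dotpNl -(enormN u) cauchy_schwarz. Qed.

Lemma ler_enormD u v : enorm (u + v) <= enorm u + enorm v.
Proof.
rewrite -(@ler_pXn2r _ 2)// ?nnegrE ?addr_ge0 ?enorm_ge0//.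
rewrite sqr_enorm !dotp_lin (dotpC v) -!sqr_enorm.
by have := cauchy_schwarz u v; lra.
Qed.

Lemma ler_enorm_sum (I : Type) (s : seq I) (F : I -> 'rV[R]_n) :
  enorm (\sum_(i <- s) F i) <= \sum_(i <- s) enorm (F i).
Proof.
elim: s => [|i s IHs]; first by rewrite !big_nil enorm0.
by rewrite !big_cons (le_trans (ler_enormD _ _))// lerD2l.
Qed.

Lemma ler_coord_enorm v i : `|v 0 i| <= enorm v.
Proof.
rewrite -sqrtr_sqr ler_wsqrtr// /dotp (bigD1 i)//= expr2 lerDl.
by apply: sumr_ge0 => j _; rewrite -expr2 sqr_ge0.
Qed.

(** The row norms of [M] provide a bound, so that [opnorm M] is a genuine
    supremum and not a default value. *)
Lemma opnorm_has_ubound M :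
  has_ubound [set enorm (v *m M) | v in [set v | enorm v <= 1]].
Proof.
exists (\sum_(i < n) enorm (row i M)) => _ [w /= w1 <-].
rewrite mulmx_sum_row (le_trans (ler_enorm_sum _ _))//.
apply: ler_sum => i _; rewrite enormZ ler_piMl ?enorm_ge0//.
exact: le_trans (ler_coord_enorm _ _) w1.
Qed.

Lemma opnorm_ge0 M : 0 <= opnorm M.
Proof.
apply: (ub_le_sup (opnorm_has_ubound M)).
by exists 0; rewrite /= ?mul0mx enorm0.
Qed.

Lemma enorm_mulmx v M : enorm (v *m M) <= opnorm M * enorm v.
Proof.
have [->|v0] := eqVneq v 0; first by rewrite mul0mx enorm0 mulr0.
rewrite -ler_pdivrMr ?enorm_gt0// mulrC.
have vV : `|(enorm v)^-1| = (enorm v)^-1.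
  by rewrite ger0_norm// invr_ge0 enorm_ge0.
rewrite -{1}vV -enormZ scalemxAl.
apply: (ub_le_sup (opnorm_has_ubound M)).
exists ((enorm v)^-1 *: v) => //=.
by rewrite enormZ vV mulVf// enorm_eq0.
Qed.

End Euclidean.

(** * Calculus along lines *)

Section Lines.
Context {R : realType} {n : nat}.
Implicit Types (f : 'rV[R]_n -> R) (x y v u : 'rV[R]_n) (t : R).

Lemma is_derive_line (W : normedModType R) (F : 'rV[R]_n -> W) x v t :
  differentiable F (x + t *: v) ->
  is_derive t 1 (fun s : R => F (x + s *: v)) ('D_v F (x + t *: v)).
Proof.
move=> /diff_derivable-/(_ v) dF.
have E : (fun h : R =>
    h^-1 *: (((fun s : R => F (x + s *: v)) \o shift t) (h *: 1)
      - F (x + t *: v))) =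
  (fun h : R => h^-1 *: ((F \o shift (x + t *: v)) (h *: v) - F (x + t *: v))).
  apply/funext => h /=; congr (_ *: (F _ - _)).
  by rewrite [h *: 1]mulr1 scalerDl addrCA.
by apply: DeriveDef; rewrite /derivable /derive E.
Qed.

Lemma derive_grad f x v : differentiable f x -> 'D_v f x = dotp (grad f x) v.
Proof.
move=> df; rewrite deriveE// {1}[v]row_sum_delta linear_sum.
by apply: eq_bigr => i _; rewrite linearZ mxE deriveE// mulrC.
Qed.

Lemma is_derive_grad_line f x v t : (forall y, differentiable f y) ->
  is_derive t 1 (fun s : R => f (x + s *: v)) (dotp (grad f (x + t *: v)) v).
Proof. by move=> df; rewrite -derive_grad//; exact: is_derive_line. Qed.

Lemma is_derive_dotp (F : R -> 'rV[R]_n) dF u t : is_derive t 1 F dF ->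
  is_derive t 1 (fun s => dotp (F s) u) (dotp dF u).
Proof.
move=> [Fd <-].
rewrite [X in is_derive _ _ X](_ : _ =
    \sum_(i < n) (u 0 i \*: (fun s => F s 0 i))); last first.
  by apply/funext => s; rewrite fct_sumE; apply: eq_bigr => i _; rewrite mulrC.
have -> : dotp ('D_1 F t) u = \sum_(i < n) u 0 i *: ('D_1 (fun s => F s 0 i) t).
  by apply: eq_bigr => i _; rewrite derive_mx// mxE mulrC.
apply: is_derive_sum => i; apply: is_deriveZ; apply: DeriveDef => //.
exact: (derivable_mxP _ _ _).1.
Qed.

Lemma is_derive_hess_line f x v u t : twice_differentiable f ->
  is_derive t 1 (fun s : R => dotp (grad f (x + s *: v)) u)
    (dotp (v *m hess f (x + t *: v)) u).
Proof.
move=> [_ d2f]; have := d2f (x + t *: v).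
move=> /[dup] /(@is_derive_line 'rV[R]_n (grad f)) /is_derive_dotp -/(_ u).
by move=> + /deriveEjacobian E; rewrite E.
Qed.

Lemma le0_derive_unit_itv (h dh : R -> R) :
  (forall t, is_derive t 1 h (dh t)) ->
  (forall t, 0 < t < 1 -> dh t <= 0) -> h 1 <= h 0.
Proof.
move=> hdh dh0.
have [|c c01] := @MVT R h dh 0 1 ltr01 (fun t _ => hdh t).
  apply: derivable_within_continuous => t _.
  by have [] := hdh t.
rewrite subr0 mulr1 -subr_le0 => ->; apply: dh0.
by move: c01; rewrite in_itv.
Qed.

(** One-sided first-order condition: the source of both the gradient inequality
    for convex functions and the variational inequality of the subproblem. *)
Lemma derive_min0_ge0 (h : R -> R) dh : is_derive (0 : R) 1 h dh ->
  (forall t, 0 <= t <= 1 -> h 0 <= h t) -> 0 <= dh.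
Proof.
move=> [hd <-] hmin.
have /cvg_dnbhs_at_right h_right :
  (t^-1 *: ((h \o shift 0) (t *: 1) - h 0)) @[t --> 0^'] --> 'D_1 h 0 by [].
apply: cvgr_to_ge h_right _; near=> t.
have t_gt0 : 0 < t by near: t; exact: nbhs_right_gt.
rewrite /= addr0 /GRing.scale/= mulr1 mulr_ge0 ?invr_ge0 ?(ltW t_gt0)//.
rewrite subr_ge0 hmin// ltW//=.
by near: t; exact: nbhs_right_le.
Unshelve. all: by end_near. Qed.

(** The two Taylor estimates integrate a polynomial bound on a derivative; the
    mean value theorem applied to [h] minus a primitive of the bound avoids
    integrals. *)
Lemma ler_taylor_unit_itv (h dh : R -> R) a b c :
  (forall t, is_derive t 1 h (dh t)) ->
  (forall t, 0 < t < 1 -> dh t <= a + b * t + c * t ^+ 2) ->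
  h 1 <= h 0 + a + b / 2 + c / 3.
Proof.
move=> hdh dh_le.
pose q := fun s : R => h s - (a * s + b / 2 * s ^+ 2 + c / 3 * s ^+ 3).
have dq t : is_derive t 1 q (dh t - (a + b * t + c * t ^+ 2)).
  have hdht := hdh t.
  by rewrite /q; apply: is_derive_eq; rewrite /GRing.scale/=; field.
have /(le0_derive_unit_itv dq) :
    forall t, 0 < t < 1 -> dh t - (a + b * t + c * t ^+ 2) <= 0.
  by move=> t t01; rewrite subr_le0 dh_le.
by rewrite /q !expr1n expr0n/=; lra.
Qed.

End Lines.

(** * Taylor estimates under a Lipschitz Hessian *)

Section Taylor.
Context {R : realType} {n : nat}.
Implicit Types (x y d u : 'rV[R]_n).
Variables (f : 'rV[R]_n -> R) (L2 : R).
Hypothesis f_diff2 : twice_differentiable f.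
Hypothesis f_hess : lipschitz_hessian L2 f.

Lemma hess_line_le x d u (t : R) : 0 <= t ->
  dotp (d *m hess f (x + t *: d)) u <=
  dotp (d *m hess f x) u + L2 * enorm d ^+ 2 * enorm u * t.
Proof.
move=> t0.
have := f_hess (x + t *: d) x.
rewrite [x + _]addrC addrK enormZ ger0_norm//.
move: (hess f _) (hess f x) => A B AB.
rewrite -lerBlDl -dotpNl -dotpDl -mulmxBr.
apply: le_trans (cauchy_schwarz _ _) _.
have := le_trans (enorm_mulmx d _) (ler_wpM2r (enorm_ge0 d) AB).
move=> /(ler_wpM2r (enorm_ge0 u))/le_trans; apply.
by apply: eq_ler; ring.
Qed.

(** Testing against a fixed [u] reduces the vector-valued estimate
    [taylor_grad] to a scalar one; [u] is then the remainder itself. *)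
Lemma taylor_grad_dotp x d u :
  dotp (grad f (x + d)) u <=
  dotp (grad f x + d *m hess f x) u + L2 / 2 * enorm d ^+ 2 * enorm u.
Proof.
have := @ler_taylor_unit_itv R (fun t : R => dotp (grad f (x + t *: d)) u) _
  (dotp (d *m hess f x) u) (L2 * enorm d ^+ 2 * enorm u) 0
  (fun t => is_derive_hess_line x d u t f_diff2).
rewrite scale1r scale0r addr0 dotpDl => H.
apply: le_trans (H _) _; last by apply: eq_ler; field.
by move=> t /andP[t0 _]; rewrite mul0r addr0 hess_line_le// ltW.
Qed.

Lemma taylor_grad x d :
  enorm (grad f (x + d) - (grad f x + d *m hess f x)) <= L2 / 2 * enorm d ^+ 2.
Proof.
set e := _ - _; have [->|e0] := eqVneq e 0.
  have [->|d0] := eqVneq d 0; first by rewrite !enorm0 expr0n mulr0.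
  have := le_trans (opnorm_ge0 _) (f_hess (x + d) x).
  rewrite addrAC subrr add0r pmulr_lge0 ?enorm_gt0// enorm0 => L2_ge0.
  by rewrite mulr_ge0 ?divr_ge0 ?sqr_ge0.
rewrite -(ler_pM2r (_ : 0 < enorm e)) ?enorm_gt0// -expr2 (sqr_enorm e).
have -> : dotp e e =
    dotp (grad f (x + d)) e - dotp (grad f x + d *m hess f x) e.
  by rewrite -dotpNl -dotpDl.
by rewrite lerBlDl taylor_grad_dotp.
Qed.

Lemma taylor_value x d :
  f (x + d) <= f x + dotp (grad f x) d + dotp (d *m hess f x) d / 2
    + L2 / 6 * enorm d ^+ 3.
Proof.
have := @ler_taylor_unit_itv R (fun t : R => f (x + t *: d)) _
  (dotp (grad f x) d) (dotp (d *m hess f x) d) (L2 / 2 * enorm d ^+ 3)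
  (fun t => is_derive_grad_line x d t f_diff2.1).
rewrite scale1r scale0r addr0 => H.
apply: le_trans (H _) _; last by apply: eq_ler; field.
move=> t /andP[t0 _]; apply: (le_trans (taylor_grad_dotp x (t *: d) d)).
rewrite enormZ (ger0_norm (ltW t0)) -scalemxAl !dotp_lin.
by apply: eq_ler; field.
Qed.

(** On the segment from [x] to [y], the chord minus [f] is nonnegative and
    vanishes at [x], so its derivative there is nonnegative. *)
Lemma convex_grad_le x y : convex_function [set: 'rV[R]_n] f ->
  f x + dotp (grad f x) (y - x) <= f y.
Proof.
move=> f_conv.
pose h (t : R) := f x + t * (f y - f x) - f (x + t *: (y - x)).
have dh : is_derive (0 : R) 1 h (f y - f x - dotp (grad f x) (y - x)).
  have := is_derive_grad_line x (y - x) 0 f_diff2.1.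
  rewrite scale0r addr0 => dfl.
  by rewrite /h; apply: is_derive_eq; rewrite /GRing.scale/=; ring.
suff : 0 <= f y - f x - dotp (grad f x) (y - x) by lra.
apply: derive_min0_ge0 dh _ => t /andP[t0 t1].
rewrite /h mul0r scale0r !addr0 subrr subr_ge0.
have := f_conv (Itv01 t0 t1) y x (mem_set I) (mem_set I).
rewrite convRE /conv/= /unstable.onem.
have -> : t *: y + (1 - t) *: x = x + t *: (y - x).
  by rewrite scalerBl scale1r scalerBr addrCA.
by move=> /le_trans; apply; lra.
Qed.

End Taylor.

(** * Strong convexity of the scaling function *)

Section ScalingFunction.
Context {R : realType} {n : nat}.
Implicit Types (rho : 'rV[R]_n -> R) (x y v : 'rV[R]_n).

Lemma strongly_convex_grad_monotone (sV : R) rho x v :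
  strongly_convex sV rho ->
  sV * enorm v ^+ 2 <= dotp (grad rho (x + v) - grad rho x) v.
Proof.
move=> rho_convex; have := rho_convex x (x + v); have := rho_convex (x + v) x.
rewrite [x + v - x]addrC addKr opprD addNKr enormN dotpNr dotpDl dotpNl.
by lra.
Qed.

(** The nonzero vector rules out the zero-dimensional space, where [sV] and
    [LV] are unrelated. *)
Lemma strong_convexity_le_lipschitz (sV LV : R) rho x v :
  strongly_convex sV rho -> lipschitz_gradient LV rho -> v != 0 -> sV <= LV.
Proof.
move=> rho_convex rho_lip; rewrite -enorm_gt0 => v_gt0.
have := rho_lip x (x + v); rewrite [x + v - x]addrC addKr.
move=> /(ler_wpM2r (ltW v_gt0)).
have := strongly_convex_grad_monotone x v rho_convex.
move=> /le_trans/(_ (cauchy_schwarz _ _))/le_trans/[apply].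
by rewrite -mulrA -expr2 ler_pM2r// exprn_gt0.
Qed.

End ScalingFunction.

(** * First-order conditions of the subproblem *)

Section TrustRegion.
Context {R : realType} {n : nat}.
Variables (f rho : 'rV[R]_n -> R).
Implicit Types (x d v p w : 'rV[R]_n) (H : 'M[R]_n) (r A : R).

Definition model_grad x H A d : 'rV[R]_n :=
  grad f x + d *m H + A *: (grad rho (x + d) - grad rho x).

Lemma dotp_symmetric H u v : H^T = H -> dotp (u *m H) v = dotp (v *m H) u.
Proof.
move=> H_sym; have dotpE a b : dotp a b = (a *m b^T) 0 0.
  by rewrite mxE; apply: eq_bigr => i _; rewrite mxE.
have E : v *m H *m u^T = (u *m H *m v^T)^T.
  by rewrite !trmx_mul trmxK H_sym mulmxA.
by rewrite !dotpE E [RHS]mxE.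
Qed.

(** Along a line the model is a quadratic polynomial plus a multiple of
    [rho]; differentiating this explicit form avoids a calculus of bilinear
    forms. *)
Lemma is_derive_model x H A d w : (forall y, differentiable rho y) -> H^T = H ->
  is_derive (0 : R) 1 (fun t : R => HAT_model f rho x H A (d + t *: w))
    (dotp (model_grad x H A d) w).
Proof.
move=> rho_diff H_sym.
have drho := is_derive_grad_line (x + d) w 0 rho_diff.
rewrite scale0r addr0 in drho.
rewrite [X in is_derive _ _ X](_ : _ = fun t : R =>
  dotp (grad f x) d + 2^-1 * dotp (d *m H) d - A * (rho x + dotp (grad rho x) d)
  + t * (dotp (grad f x) w + dotp (d *m H) w - A * dotp (grad rho x) w)
  + t ^+ 2 * (2^-1 * dotp (w *m H) w) + A * rho (x + d + t *: w)); last first.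
  apply/funext => t; rewrite /HAT_model /bregman [x + _ - x]addrC addKr addrA.
  rewrite mulmxDl -scalemxAl !dotp_lin (dotp_symmetric w d H_sym).
  by field.
apply: is_derive_eq; rewrite /model_grad !dotp_lin /GRing.scale/=.
by ring.
Qed.

Lemma HAT_feasibleE x r v : 0 <= r ->
  HAT_feasible f x r v <-> enorm v <= r * Num.sqrt (enorm (grad f x)).
Proof.
move=> r0; rewrite /HAT_feasible/=.
rewrite -[X in _ * X](@sqr_sqrtr _ (enorm _)) ?enorm_ge0//.
by rewrite -exprMn ler_pXn2r ?nnegrE ?enorm_ge0 ?mulr_ge0 ?sqrtr_ge0.
Qed.

(** The ball is convex, so the segment from [d] to [v] is feasible and the model
    is least at its endpoint [d]. *)
Lemma HAT_variational_inequality x H r A d v :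
  (forall y, differentiable rho y) -> H^T = H -> 0 <= r ->
  HAT_subproblem_solution f rho x H r A d ->
  enorm v <= r * Num.sqrt (enorm (grad f x)) ->
  0 <= dotp (model_grad x H A d) (v - d).
Proof.
move=> rho_diff H_sym r0 [/(HAT_feasibleE _ _ r0) d_feas d_min] v_feas.
apply: derive_min0_ge0 (is_derive_model x A d (v - d) rho_diff H_sym) _.
move=> t /andP[t0 t1]; rewrite scale0r addr0; apply: d_min.
apply/(HAT_feasibleE _ _ r0).
have -> : d + t *: (v - d) = t *: v + (1 - t) *: d.
  by rewrite scalerBl scale1r scalerBr addrCA.
rewrite (le_trans (ler_enormD _ _))// !enormZ (ger0_norm t0).
rewrite ger0_norm ?subr_ge0//.
have := ler_wpM2l t0 v_feas; have := ler_wpM2l (_ : 0 <= 1 - t) d_feas.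
by rewrite subr_ge0 => /(_ t1); lra.
Qed.

(** The test point [- (rad / enorm p) *: p] minimises the linear form [dotp p]
    over the ball.  The conclusion carries all the information on the
    multiplier of the ball constraint that the estimates of a step use. *)
Lemma ball_variational_inequality p d (rad : R) : 0 <= rad ->
  (forall v, enorm v <= rad -> 0 <= dotp p (v - d)) ->
  rad * enorm p <= - dotp p d.
Proof.
move=> rad0 vi; have [->|] := eqVneq p 0.
  by rewrite enorm0 dot0p oppr0 mulr0.
rewrite -enorm_gt0 => p_gt0; have := vi (- (rad / enorm p) *: p).
rewrite enormZ normrN ger0_norm ?divr_ge0 ?(ltW p_gt0)// divfK ?gt_eqF//.
move=> /(_ (lexx _)); rewrite !dotp_lin -sqr_enorm.
have -> : - (rad / enorm p) * enorm p ^+ 2 = - (rad * enorm p).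
  by field; rewrite gt_eqF.
by lra.
Qed.

End TrustRegion.

(** * One iteration *)

Section Step.
Context {R : realType} {n : nat}.
Variables (f rho : 'rV[R]_n -> R) (L2 sV LV eta xi : R).
Hypothesis f_diff2 : twice_differentiable f.
Hypothesis f_hess : lipschitz_hessian L2 f.
Hypothesis rho_diff : forall y, differentiable rho y.
Hypothesis rho_convex : strongly_convex sV rho.
Hypothesis rho_grad : lipschitz_gradient LV rho.
Hypothesis sV_LV : LV < 2 * sV.
Hypothesis eta_gt0 : 0 < eta.
Hypothesis xi_gt0 : 0 < xi.

Let B := L2 / 2 + LV * ((2 * eta + L2 / 3) / (2 * sV - LV)).
Let c := 1 + LV / (2 * sV - LV).

Lemma lipschitz_hessian_ge0 (v : 'rV[R]_n) : v != 0 -> 0 <= L2.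
Proof.
rewrite -enorm_gt0 => v_gt0; have := le_trans (opnorm_ge0 _) (f_hess v 0).
by rewrite subr0 pmulr_lge0.
Qed.

(** A nonzero vector, in practice a nonzero gradient, makes the parameters
    consistent: [LV < 2 sV] alone allows negative constants in dimension 0. *)
Lemma curvature_constants (v : 'rV[R]_n) : v != 0 ->
  [/\ 0 <= L2, 0 < sV, sV <= LV, 0 < B & 0 < c].
Proof.
move=> v0; have L2_ge0 := lipschitz_hessian_ge0 v0.
have sLV := strong_convexity_le_lipschitz 0 rho_convex rho_grad v0.
have sV0 : 0 < sV by move: sV_LV; lra.
have LV0 : 0 < LV by lra.
have k0 : 0 < 2 * sV - LV by rewrite subr_gt0.
split=> //; last by rewrite addr_gt0// divr_gt0.
rewrite ltr_wpDl ?divr_ge0// mulr_gt0// divr_gt0//.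
by rewrite ltr_pwDl ?mulr_gt0 ?divr_ge0.
Qed.

(** Here [a] stands for the relative inexactness and [Q] for [sqrt (xi B)].  By
    the choice of [r], [r a c + r Q = xi]; in particular [r Q <= xi], so that
    [r^2 B = (r Q)^2 / xi <= r Q]. *)
Lemma radius_contraction (a Q r : R) : 0 <= a -> 0 < c -> 0 < Q ->
  Q ^+ 2 = xi * B -> r = xi * (a * c + Q)^-1 -> r * a * c + r ^+ 2 * B <= xi.
Proof.
move=> a0 c0 Q0 QB rE.
have acQ : 0 < a * c + Q by rewrite ltr_wpDl// mulr_ge0// ltW.
have r_gt0 : 0 < r by rewrite rE mulr_gt0// invr_gt0.
have rac : r * a * c + r * Q = xi.
  by rewrite rE; field; rewrite gt_eqF.
have rac_ge0 : 0 <= r * a * c by rewrite !mulr_ge0// ltW.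
have rQ : r * Q <= xi by lra.
suff : r ^+ 2 * B <= r * Q by lra.
rewrite -(ler_pM2l xi_gt0).
have -> : xi * (r ^+ 2 * B) = r * Q * (r * Q) by rewrite mulrCA -QB; ring.
by rewrite ler_pM2r// mulr_gt0.
Qed.

Let Q := Num.sqrt (xi * B).

Lemma HAT_radius_ge (x : 'rV[R]_n) (H : 'M[R]_n) (Delta : R) :
  grad f x != 0 ->
  opnorm (hess f x - H) / Num.sqrt (enorm (grad f x)) <= Delta ->
  xi / (Delta * c + Q) <= HAT_radius f L2 sV LV eta xi x H.
Proof.
move=> g0 a_le; have [_ _ _ B0 c0] := curvature_constants g0.
have Q0 : 0 < Q by rewrite sqrtr_gt0 mulr_gt0.
rewrite ler_wpM2l ?(ltW xi_gt0)// lef_pV2 ?lerD2r ?ler_wpM2r ?(ltW c0)//.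
  rewrite posrE ltr_wpDl ?mulr_ge0 ?(ltW c0)//.
  by rewrite (le_trans _ a_le)// divr_ge0 ?opnorm_ge0 ?sqrtr_ge0.
by rewrite posrE ltr_wpDl ?mulr_ge0 ?divr_ge0 ?opnorm_ge0 ?sqrtr_ge0 ?(ltW c0).
Qed.

(** A finite relative inexactness keeps the radii away from 0, so that steps to
    the sphere have a length comparable with [sqrt |g|]. *)
Lemma HAT_radius_lower_bound (v : 'rV[R]_n) (Delta : R) : v != 0 -> 0 <= Delta ->
  exists2 rmin, 0 < rmin & forall x H, grad f x != 0 ->
    opnorm (hess f x - H) / Num.sqrt (enorm (grad f x)) <= Delta ->
    rmin <= HAT_radius f L2 sV LV eta xi x H.
Proof.
move=> v0 Delta0; have [_ _ _ B0 c0] := curvature_constants v0.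
exists (xi / (Delta * c + Q)) => [|x H]; last exact: HAT_radius_ge.
by rewrite divr_gt0// ltr_wpDl ?mulr_ge0 ?(ltW c0)// sqrtr_gt0 mulr_gt0.
Qed.

(** With [p] the gradient of the model at [d], the descent comes from
    [<g, d> = <p, d> - <d H, d> - A <w, d>], where [<p, d> <= 0] and the two
    other terms are bounded by [H_ge] and strong convexity; the gradient bounds
    come from writing the new gradient as [p] plus error terms.  An interior
    [d] forces [p = 0]. *)
Lemma HAT_step (x d : 'rV[R]_n) (H : 'M[R]_n) (r A : R) :
  grad f x != 0 -> H^T = H ->
  HAT_subproblem_solution f rho x H r A d ->
  r = HAT_radius f L2 sV LV eta xi x H ->
  A = HAT_weight f L2 sV LV eta x H r ->
  loewner_le ((LV - sV) * A)%:M H ->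
  let rad := r * Num.sqrt (enorm (grad f x)) in
  [/\ 0 < r, enorm d <= rad,
      f (x + d) <= f x - eta * rad * enorm d ^+ 2,
      enorm (grad f (x + d)) <= (1 + xi) * enorm (grad f x)
    & enorm d < rad -> enorm (grad f (x + d)) <= xi * enorm (grad f x)].
Proof.
move=> g0 H_sym d_sol rE AE H_ge rad.
have [L2_ge0 sV0 sLV B0 c0] := curvature_constants g0.
have k0 : 0 < 2 * sV - LV by rewrite subr_gt0.
set g := grad f x in g0 rad *.
set delta := opnorm (hess f x - H).
have delta0 : 0 <= delta := opnorm_ge0 _.
set s := Num.sqrt (enorm g) in rad *.
have s0 : 0 < s by rewrite sqrtr_gt0 enorm_gt0.
have s2 : s ^+ 2 = enorm g by rewrite sqr_sqrtr ?enorm_ge0.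
have Q0 : 0 < Q by rewrite sqrtr_gt0 mulr_gt0.
have Q2 : Q ^+ 2 = xi * B by rewrite sqr_sqrtr// ltW// mulr_gt0.
pose a := delta / s; have a0 : 0 <= a by rewrite divr_ge0// ltW.
have rE' : r = xi * (a * c + Q)^-1 by [].
have acQ : 0 < a * c + Q by rewrite ltr_wpDl// mulr_ge0// ltW.
have r_gt0 : 0 < r by rewrite rE' mulr_gt0// invr_gt0.
have rad0 : 0 < rad by rewrite mulr_gt0.
have contr := radius_contraction a0 c0 Q0 Q2 rE'.
have d_rad : enorm d <= rad.
  by have [/(HAT_feasibleE _ _ _ (ltW r_gt0))] := d_sol.
have vi := ball_variational_inequality (ltW rad0) (fun v =>
  @HAT_variational_inequality _ _ f rho x H r A d v rho_diff H_sym
    (ltW r_gt0) d_sol).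
set p := model_grad f rho x H A d in vi.
have drho := strongly_convex_grad_monotone x d rho_convex.
have rholip := rho_grad x (x + d).
rewrite [x + d - x]addrC addKr in rholip.
set w := grad rho (x + d) - grad rho x in drho rholip.
have A0 : 0 <= A.
  rewrite AE /HAT_weight addr_ge0 ?divr_ge0 ?(ltW k0)//.
  rewrite mulr_ge0 ?divr_ge0 ?(ltW k0) ?(ltW rad0)//.
  by rewrite addr_ge0 ?divr_ge0 ?mulr_ge0 ?(ltW eta_gt0).
have kA : (2 * sV - LV) * A = delta + rad * (2 * eta + L2 / 3).
  by rewrite AE /HAT_weight -/g -/s -/rad -/delta; field; rewrite gt_eqF.
have dHd : (LV - sV) * A * enorm d ^+ 2 <= dotp (d *m H) d.
  have := H_ge d; rewrite mulmxBr mul_mx_scalar !dotp_lin -sqr_enorm.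
  by rewrite subr_ge0.
have pE : dotp p d = dotp g d + dotp (d *m H) d + A * dotp w d.
  by rewrite /p /model_grad !dotp_lin.
have d0 := enorm_ge0 d; have p0 := enorm_ge0 p; have gn0 := enorm_ge0 g.
have d2 : 0 <= enorm d ^+ 2 by rewrite sqr_ge0.
have Awd : A * (sV * enorm d ^+ 2) <= A * dotp w d by rewrite ler_wpM2l.
have errd : dotp (d *m hess f x) d - dotp (d *m H) d <= delta * enorm d ^+ 2.
  rewrite -dotpNl -dotpDl -mulmxBr (le_trans (cauchy_schwarz _ _))//.
  by rewrite expr2 mulrA ler_wpM2r// enorm_mulmx.
have descent : f (x + d) <= f x - eta * rad * enorm d ^+ 2.
  have := taylor_value f_diff2 f_hess x d; rewrite -/g.
  have vp : 0 <= rad * enorm p by rewrite mulr_ge0// ltW.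
  have d3 : enorm d ^+ 3 <= rad * enorm d ^+ 2 by rewrite exprS ler_wpM2r.
  have Ld3 : L2 / 6 * enorm d ^+ 3 <= L2 / 6 * (rad * enorm d ^+ 2).
    by rewrite ler_wpM2l// divr_ge0.
  have kAd : (2 * sV - LV) * A * enorm d ^+ 2 =
      delta * enorm d ^+ 2 + rad * (2 * eta + L2 / 3) * enorm d ^+ 2.
    by rewrite kA mulrDl.
  (* The available curvature [(LV + sV) / 2] exceeds the required
     [(2 sV - LV) / 2] because [sV <= 2 LV]. *)
  have AV : 0 <= (2 * LV - sV) * (A * enorm d ^+ 2).
    by rewrite !mulr_ge0//; lra.
  move: pE vi dHd Awd errd AV kAd Ld3.
  by lra.
have p_le : enorm p <= enorm g.
  rewrite -(ler_pM2l rad0) (le_trans vi)// pE.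
  have gd := cauchy_schwarzN g d.
  have gdr : enorm g * enorm d <= enorm g * rad by rewrite ler_wpM2l.
  have H0 : 0 <= (LV - sV) * A * enorm d ^+ 2 by rewrite !mulr_ge0// subr_ge0.
  have A1 : 0 <= A * (sV * enorm d ^+ 2) by rewrite !mulr_ge0// ltW.
  by lra.
have grad_le : enorm (grad f (x + d)) <= enorm p + xi * enorm g.
  have -> : grad f (x + d) = p + d *m (hess f x - H) - A *: w
      + (grad f (x + d) - (g + d *m hess f x)).
    rewrite /p /model_grad -/w -/g mulmxBr.
    move: (grad f (x + d)) (d *m hess f x) (d *m H) (A *: w) => a1 a2 a3 a4.
    by apply/rowP => i; rewrite !mxE; ring.
  have T := taylor_grad f_diff2 f_hess x d.
  rewrite (le_trans (ler_enormD _ _))//.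
  rewrite (le_trans (lerD (ler_enormD _ _) T))//.
  rewrite (le_trans (lerD (lerD (ler_enormD _ _) (lexx _)) (lexx _)))//.
  rewrite enormN enormZ (ger0_norm A0) -!addrA lerD2l.
  have e1 := le_trans (enorm_mulmx d (hess f x - H)) (ler_wpM2l delta0 d_rad).
  have e2 : A * enorm w <= A * (LV * rad).
    by rewrite ler_wpM2l// (le_trans rholip)// ler_wpM2l//; lra.
  have e3 : L2 / 2 * enorm d ^+ 2 <= L2 / 2 * rad ^+ 2.
    by rewrite ler_wpM2l ?divr_ge0// ler_pXn2r ?nnegrE// ltW.
  have AE' : A = (delta + rad * (2 * eta + L2 / 3)) / (2 * sV - LV).
    by rewrite -kA; field; rewrite gt_eqF.
  have tot : delta * rad + (A * (LV * rad) + L2 / 2 * rad ^+ 2) =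
      (r * a * c + r ^+ 2 * B) * s ^+ 2.
    by rewrite AE' /a /c /B /rad; field; rewrite !gt_eqF.
  have := ler_wpM2r (sqr_ge0 s) contr; rewrite -tot s2 -/delta in e1 *.
  by lra.
split=> // [|d_lt]; first by rewrite mulrDl mul1r (le_trans grad_le)// lerD2r.
have p_rad : enorm p * (rad - enorm d) <= 0.
  rewrite mulrBr subr_le0 [leLHS]mulrC (le_trans vi)// lerNl.
  exact: cauchy_schwarzN.
rewrite (le_trans grad_le)// gerDr.
by rewrite -(pmulr_lle0 _ (_ : 0 < rad - enorm d)) ?subr_gt0.
Qed.

End Step.

(** * Counting two kinds of steps *)

Lemma excess_count (a b N : nat) : (a + b)%N = N -> (3 * a < N)%N ->
  exists2 m, b = (a + m)%N & (N <= 3 * m)%N.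
Proof. by move=> abN aN; exists (b - a)%N; lia. Qed.

Section MixedRate.
Context {R : realType}.
Variables (c D xi : R).
Hypotheses (c_gt0 : 0 < c) (D_gt0 : 0 < D) (xi_gt0 : 0 < xi).
Hypothesis xi_golden : xi * (1 + xi) <= 1.
Implicit Types (phi g : nat -> R).

(** The two kinds of steps, on the sphere and in the interior of the ball,
    reduced to what they do to the gap [phi] and to the gradient norm [g]. *)
Definition mixed_step phi g k : Prop :=
  (phi k.+1 <= phi k - c * Num.sqrt (phi k) ^+ 3 /\ g k.+1 <= (1 + xi) * g k)
  \/ (phi k.+1 <= phi k /\ g k.+1 <= xi * g k).

(** Discrete form of [(u^(-1/2))' >= c / 2] for [u' = - c u^(3/2)], with [t] in
    the role of a lower bound of [u^(-1/2)]; stated with products, it covers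
    [u = 0]. *)
Lemma sqrt_decrease (t u v : R) : 0 <= t -> 0 <= v -> 0 <= u ->
  v <= u - c * Num.sqrt u ^+ 3 -> t * Num.sqrt u <= 1 ->
  (t + c / 2) * Num.sqrt v <= 1.
Proof.
move=> t0 v0 u0; set psi := Num.sqrt u; set chi := Num.sqrt v.
have psi0 : 0 <= psi := sqrtr_ge0 _; have chi0 : 0 <= chi := sqrtr_ge0 _.
have <- : psi ^+ 2 = u by rewrite sqr_sqrtr.
have <- : chi ^+ 2 = v by rewrite sqr_sqrtr.
move=> dec tpsi.
have [psi_eq0|psi_neq0] := eqVneq psi 0.
  have : chi ^+ 2 <= 0 by move: dec; rewrite psi_eq0 !expr0n/= mulr0 subr0.
  by rewrite exprn_even_le0//= => /eqP->; rewrite mulr0.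
have psi_gt0 : 0 < psi by rewrite lt_def psi_neq0.
have cpsi : 0 <= 1 - c * psi.
  by rewrite -(pmulr_rge0 _ (exprn_gt0 2 psi_gt0)); have := sqr_ge0 chi; lra.
have q0 : 0 <= psi * (1 - c * psi / 2) by rewrite mulr_ge0//; lra.
have chi_le : chi <= psi * (1 - c * psi / 2).
  (* [1 - c psi <= (1 - c psi / 2)^2]. *)
  rewrite -(@ler_pXn2r _ 2)// ?nnegrE// (le_trans dec)//.
  by have := sqr_ge0 (c * psi * psi / 2); lra.
have tc : 0 <= t + c / 2 by rewrite addr_ge0// divr_ge0// ltW.
rewrite (le_trans (ler_wpM2l tc chi_le))//.
(* [t psi <= 1] reduces the product to [(1 + c psi / 2) (1 - c psi / 2)]. *)
have h1 : 0 <= 1 - c * psi / 2 by lra.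
have := ler_wpM2r h1 tpsi; have := sqr_ge0 (c * psi / 2).
by lra.
Qed.

Lemma mixed_step_count phi g N : (forall k, 0 <= phi k) -> 0 <= g 0%N ->
  (forall k, (k < N)%N -> mixed_step phi g k) ->
  exists a b : nat, [/\ (a + b = N)%N,
    g N <= (1 + xi) ^+ a * xi ^+ b * g 0%N
    & c / 2 * a%:R * Num.sqrt (phi N) <= 1].
Proof.
move=> phi0 g0; elim: N => [_|N IHN stepN].
  by exists 0%N, 0%N; split=> //; rewrite ?expr0 ?mul1r// mulr0 mul0r.
have [k kN|a [b [abN gN phiN]]] := IHN.
  by apply: stepN; rewrite ltnS ltnW.
have [[dec grow]|[dec shrink]] := stepN N (ltnSn N).
  exists a.+1, b; split; first by rewrite addSn abN.
    apply: le_trans grow _.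
    rewrite exprS -!mulrA ler_wpM2l ?addr_ge0 ?(ltW xi_gt0)//.
    by rewrite mulrA.
  have -> : c / 2 * a.+1%:R = c / 2 * a%:R + c / 2.
    by rewrite -[a.+1]addn1 natrD mulrDr mulr1.
  apply: (sqrt_decrease _ _ _ dec phiN) => //.
  by rewrite mulr_ge0// divr_ge0// ltW.
exists a, b.+1; split; first by rewrite addnS abN.
  apply: le_trans shrink _.
  have -> : (1 + xi) ^+ a * xi ^+ b.+1 * g 0%N =
      xi * ((1 + xi) ^+ a * xi ^+ b * g 0%N).
    by rewrite exprS; ring.
  by rewrite ler_wpM2l// ltW.
apply: le_trans phiN; rewrite ler_wpM2l ?ler_wsqrtr//.
by rewrite mulr_ge0// divr_ge0// ltW.
Qed.

Lemma oppr_ln_xi_gt0 : 0 < - ln xi.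
Proof.
rewrite oppr_gt0 ln_lt0// xi_gt0 ltNge; apply/negP => xi_ge1.
have : 1 <= xi * xi by rewrite mulr_ege1.
by move: xi_golden; lra.
Qed.

(** If a third of the steps are on the sphere, the decrease of [phi] suffices;
    otherwise the interior steps outnumber them by [m >= N / 3], and the
    gradient bound [xi^m] gives the result through [phi <= D g]. *)
Lemma mixed_step_small phi g N eps : (forall k, 0 <= phi k) -> 0 < g 0%N ->
  0 < eps ->
  (forall k, (k < N)%N -> mixed_step phi g k) -> phi N <= D * g N ->
  6 / c / Num.sqrt eps <= N%:R ->
  3 * (ln (D * g 0%N) + ln eps^-1) <= N%:R * - ln xi ->
  phi N <= eps.
Proof.
move=> phi0 g0 eps0 steps phig N1 N2.
have se0 : 0 < Num.sqrt eps by rewrite sqrtr_gt0.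
have [a [b [abN gN phiN]]] := mixed_step_count phi0 (ltW g0) steps.
have [Na|aN] := leqP N (3 * a).
  have Na' : N%:R <= 3 * a%:R :> R by rewrite -natrM ler_nat.
  have a_large : 1 <= c / 2 * a%:R * Num.sqrt eps.
    have := le_trans N1 Na'; rewrite ler_pdivrMr// ler_pdivrMr//.
    by lra.
  have ca : 0 < c / 2 * a%:R.
    by rewrite -(pmulr_lgt0 _ se0) (lt_le_trans ltr01).
  by have := le_trans phiN a_large; rewrite ler_pM2l// ler_sqrt ?(ltW eps0).
have [m mN Nm'] := excess_count abN aN.
have Nm : N%:R <= 3 * m%:R :> R by rewrite -natrM ler_nat.
have lnxi := oppr_ln_xi_gt0.
have Dg : 0 < D * g 0%N by rewrite mulr_gt0.
apply: le_trans phig _.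
have gm : g N <= xi ^+ m * g 0%N.
  apply: le_trans gN _; rewrite ler_wpM2r ?(ltW g0)//.
  rewrite mN exprD mulrA -exprMn [(1 + xi) * xi]mulrC.
  rewrite -[leRHS]mul1r ler_wpM2r ?exprn_ge0 ?(ltW xi_gt0)//.
  by rewrite exprn_ile1// ltW// mulr_gt0// addr_gt0.
rewrite (le_trans (ler_wpM2l (ltW D_gt0) gm))// mulrCA mulrC.
rewrite -ler_ln ?posrE ?mulr_gt0 ?exprn_gt0// lnM ?posrE ?mulr_gt0 ?exprn_gt0//.
rewrite lnXn// -[_ *+ m]mulr_natr.
rewrite lnV ?posrE// in N2.
have := ler_wpM2r (ltW lnxi) Nm.
by lra.
Qed.

(** For [eps <= 1/2] the bracket is at least 1, which absorbs both the rounding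
    of [N] and the constant [ln (D * g 0)] into [C]. *)
Lemma mixed_step_complexity phi g : (forall k, 0 <= phi k) -> 0 < g 0%N ->
  exists2 C : R, 0 < C &
    forall eps : R, 0 < eps -> eps <= 2^-1 ->
      exists N : nat, N%:R <= C * ((Num.sqrt eps)^-1 + ln eps^-1) /\
        ((forall k, (k < N)%N -> mixed_step phi g k) -> phi N <= D * g N ->
         phi N <= eps).
Proof.
move=> phi0 g0.
have lnxi := oppr_ln_xi_gt0.
pose M := `|ln (D * g 0%N)| + 1.
have M0 : 0 < M by rewrite ltr_wpDl.
pose K := 6 / c + 3 * M / - ln xi.
have K1 : 0 < 6 / c by rewrite divr_gt0.
have K2 : 0 < 3 * M / - ln xi by rewrite divr_gt0// mulr_gt0.
have K0 : 0 < K by rewrite addr_gt0.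
exists (K + 1) => [|eps eps0 eps_le]; first by rewrite addr_gt0.
have se0 : 0 < Num.sqrt eps by rewrite sqrtr_gt0.
have seV : 1 <= (Num.sqrt eps)^-1.
  rewrite invf_ge1// -[leRHS]sqrtr1 ler_wsqrtr// (le_trans eps_le)//.
  by rewrite invf_le1// ler1n.
have lnV0 : 0 <= ln eps^-1.
  by rewrite ln_ge0// invf_ge1// (le_trans eps_le)// invf_le1// ler1n.
set T := _^-1 + _; have T1 : 1 <= T by rewrite /T; lra.
have T0 : 0 < T by rewrite (lt_le_trans ltr01).
exists (Num.truncn (K * T)).+1; split.
  rewrite -[(Num.truncn _).+1]addn1 natrD [leRHS]mulrDl mul1r lerD//.
  by rewrite truncn_le mulr_ge0// ltW.
have NT : K * T <= (Num.truncn (K * T)).+1%:R by rewrite ltW// truncnS_gt.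
move=> steps phig; apply: mixed_step_small steps phig _ _ => //.
  apply: le_trans NT; rewrite /K mulrDl.
  have : 6 / c * (Num.sqrt eps)^-1 <= 6 / c * T.
    by rewrite ler_wpM2l ?(ltW K1)// lerDl.
  by have := mulr_gt0 K2 T0; lra.
have := ler_wpM2r (ltW lnxi) NT; apply: le_trans.
have -> : K * T * - ln xi = 6 / c * T * - ln xi + 3 * M * T.
  by rewrite /K; field; rewrite -(oppr_eq0 (ln xi)) !gt_eqF.
have P : 0 < 6 / c * T * - ln xi by rewrite !mulr_gt0// invr_gt0.
suff : ln (D * g 0%N) + ln eps^-1 <= M * T by lra.
rewrite /M mulrDl mul1r lerD//; last by rewrite lerDr; lra.
by rewrite (le_trans (ler_norm _))// ler_peMr.
Qed.

End MixedRate.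

(** * Suprema, infima and constants *)

Section Auxiliary.
Context {R : realType}.

Lemma ereal_sup_lty_bound (I : Type) (P : set I) (F : I -> R) :
  (ereal_sup [set (F i)%:E | i in P] < +oo)%E ->
  exists2 M, 0 <= M & forall i, P i -> F i <= M.
Proof.
move=> sup_lty.
have F_le i : P i -> ((F i)%:E <= ereal_sup [set (F i)%:E | i in P])%E.
  by move=> Pi; apply: ereal_sup_ubound; exists i.
case: (ereal_sup _) sup_lty F_le => [m| |]// _ F_le.
  exists `|m| => // i /F_le; rewrite lee_fin => /le_trans; apply.
  exact: ler_norm.
by exists 0 => // i /F_le.
Qed.

Lemma inf_range_min (T : Type) (f : T -> R) (y : T) : has_lbound (range f) ->
  (forall z, f y <= f z) -> inf (range f) = f y.
Proof.
move=> f_inf y_min; apply/eqP; rewrite eq_le; apply/andP; split.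
  by apply: ge_inf => //; exists y.
by apply: lb_le_inf => [|_ [z _ <-]//]; exists (f y), y.
Qed.

(** The bound on [xi] is the positive root of [xi^2 + xi = 1]. *)
Lemma golden_ratio_bound (xi : R) : 0 < xi -> xi <= (Num.sqrt 5 - 1) / 2 ->
  xi * (1 + xi) <= 1.
Proof.
move=> xi0 xi_le; have h : 2 * xi + 1 <= Num.sqrt 5 by lra.
have : (2 * xi + 1) ^+ 2 <= Num.sqrt 5 ^+ 2.
  by rewrite ler_pXn2r ?nnegrE ?sqrtr_ge0// addr_ge0// mulr_ge0// ltW.
by rewrite sqr_sqrtr//; lra.
Qed.

(** Turns [phi <= D |g|] into a lower bound on the decrease of a sphere step;
    [s] stands for [sqrt |g|]. *)
Lemma sqrtr_cubic_le (phi D s : R) : 0 < D -> 0 <= s -> phi <= D * s ^+ 2 ->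
  Num.sqrt phi ^+ 3 / Num.sqrt D ^+ 3 <= s ^+ 3.
Proof.
move=> D0 s0 phi_le; have sD : 0 < Num.sqrt D by rewrite sqrtr_gt0.
rewrite -expr_div_n ler_pXn2r ?nnegrE ?divr_ge0 ?sqrtr_ge0//.
rewrite ler_pdivrMr// (le_trans (ler_wsqrtr phi_le))//.
by rewrite (sqrtrM _ (ltW D0)) sqrtr_sqr ger0_norm// mulrC.
Qed.

Lemma reached_or_stationary (n : nat) (f : 'rV[R]_n -> R) (x : nat -> 'rV[R]_n) N :
  HAT_reached f x N \/
  exists2 j, (j < N)%N & HAT_reached f x j /\ grad f (x j) = 0.
Proof.
elim: N => [|N [reachN|[j jN reach_j]]]; first by left.
  have [gN|gN] := eqVneq (grad f (x N)) 0; first by right; exists N.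
  left=> j; rewrite ltnS leq_eqVlt => /predU1P[->//|]; exact: reachN.
by right; exists j => //; rewrite ltnS ltnW.
Qed.

End Auxiliary.

(** * The run of the method and its complexity *)

Theorem theorem3 (R : realType) (n : nat) (f rho : 'rV[R]_n -> R)
    (x0 xstar : 'rV[R]_n) (L2 G sV LV eta xi : R)
    (x d : nat -> 'rV[R]_n) (H : nat -> 'M[R]_n) (r A : nat -> R)
    (f_convex : convex_function [set: 'rV[R]_n] f)
    (f_diff2 : twice_differentiable f)
    (f_inf : has_lbound (range f))
    (f_hess : lipschitz_hessian L2 f)
    (xstar_min : forall y, f xstar <= f y)
    (D_finite :
      (ereal_sup [set (enorm (y - xstar))%:E | y in sublevel f x0] < +oo)%E)
    (G_bound : forall y, sublevel f x0 y -> enorm (grad f y) <= G)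
    (rho_diff : forall y, differentiable rho y)
    (rho_convex : strongly_convex sV rho)
    (rho_grad : lipschitz_gradient LV rho)
    (sV_LV : LV < 2 * sV)
    (eta_gt0 : 0 < eta)
    (xi_gt0 : 0 < xi)
    (xi_le : xi <= (Num.sqrt 5 - 1) / 2)
    (run : HAT_run f rho x0 x d H r A)
    (params : HAT_parameters f L2 sV LV eta xi x H r A)
    (H_ge : forall k, HAT_performed f x k ->
      loewner_le (((LV - sV) * A k)%:M) (H k))
    (Delta_finite : (relative_inexactness f x H < +oo)%E) :
  exists2 C : R, 0 < C &
    forall eps : R, 0 < eps -> eps <= 2^-1 ->
      exists k : nat,
        [/\ HAT_reached f x k,
            k%:R <= C * ((Num.sqrt eps)^-1 + ln eps^-1)
          & f (x k) - inf (range f) <= eps].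
Proof.
rewrite (inf_range_min f_inf xstar_min).
have [x0E runE] := run.
pose phi k := f (x k) - f xstar; pose g k := enorm (grad f (x k)).
have phi0 k : 0 <= phi k by rewrite subr_ge0.
have grad_ge y : f y - f xstar <= enorm (y - xstar) * enorm (grad f y).
  have := convex_grad_le f_diff2 y xstar f_convex.
  have := cauchy_schwarz (grad f y) (y - xstar).
  by rewrite -[xstar - y]opprB dotpNr; lra.
have stationary j : grad f (x j) = 0 -> phi j <= 0.
  by move=> gj; rewrite /phi (le_trans (grad_ge _))// gj enorm0 mulr0.
have [g0|g0] := eqVneq (grad f (x 0%N)) 0.
  exists 1 => // eps eps0 eps_le; exists 0%N; split=> //.
    rewrite mul1r addr_ge0 ?invr_ge0 ?sqrtr_ge0// ln_ge0// invf_ge1//.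
    by rewrite (le_trans eps_le)// invf_le1// ler1n.
  exact: le_trans (stationary 0%N g0) (ltW eps0).
have [M M0 distM] := ereal_sup_lty_bound D_finite.
have [Delta Delta0 a_le] := ereal_sup_lty_bound Delta_finite.
have [rmin rmin0 r_ge] := HAT_radius_lower_bound f_hess rho_convex rho_grad
  sV_LV eta_gt0 xi_gt0 g0 Delta0.
(* The term 1 only makes [D] positive. *)
pose D := M + enorm (x0 - xstar) + 1.
have D0 : 0 < D by rewrite ltr_wpDl// addr_ge0// enorm_ge0.
pose c := eta * rmin ^+ 3 / Num.sqrt D ^+ 3.
have c0 : 0 < c by rewrite divr_gt0 ?mulr_gt0 ?exprn_gt0 ?sqrtr_gt0.
have step k : HAT_performed f x k ->
    [/\ 0 < r k, enorm (d k) <= r k * Num.sqrt (g k),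
      f (x k.+1) <= f (x k) - eta * (r k * Num.sqrt (g k)) * enorm (d k) ^+ 2,
      g k.+1 <= (1 + xi) * g k
    & enorm (d k) < r k * Num.sqrt (g k) -> g k.+1 <= xi * g k].
  move=> perf; have [H_sym d_sol xS] := runE k perf.
  have [rE AE] := params k perf; rewrite /g xS.
  exact: (HAT_step f_diff2 f_hess rho_diff rho_convex rho_grad sV_LV eta_gt0
    xi_gt0 (perf k (leqnn k)) H_sym d_sol rE AE (H_ge k perf)).
have reachP N k : HAT_reached f x N -> (k < N)%N -> HAT_performed f x k.
  by move=> reach kN j jk; apply: reach; exact: leq_ltn_trans kN.
have phi_le k : HAT_reached f x k -> phi k <= D * g k.
  move=> reach; apply: le_trans (grad_ge _) _.
  rewrite ler_wpM2r ?enorm_ge0//.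
  (* The initial point is not in its own strict sublevel set, hence the separate
     term of [D]; a run can stay there only through null steps. *)
  suff [->|/distM xM] : x k = x0 \/ sublevel f x0 (x k).
  - by rewrite /D; lra.
  - by rewrite /D; have := enorm_ge0 (x0 - xstar); lra.
  elim: k reach => [|k IHk] reach; first by left.
  have perf := reachP _ _ reach (ltnSn k).
  have [_ _ xS] := runE k perf; have [rk0 _ dec _ _] := step k perf.
  have [dk0|dk0] := eqVneq (d k) 0.
    by rewrite xS dk0 addr0; apply: IHk => j jk; apply: perf; exact: ltnW.
  have lt_f : f (x k.+1) < f (x k).
    apply: le_lt_trans dec _; rewrite gtrDl oppr_lt0.
    rewrite !mulr_gt0 ?exprn_gt0 ?enorm_gt0// sqrtr_gt0 enorm_gt0.
    exact: perf.
  right; rewrite /sublevel/=; apply: lt_le_trans lt_f _.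
  have [j jk||] := IHk; first by apply: perf; exact: ltnW.
    by move=> ->.
  by move=> /ltW.
have mixed k : HAT_performed f x k -> mixed_step c xi phi g k.
  move=> perf; have [rk0 d_le dec growth shrink] := step k perf.
  have [_ _ xS] := runE k perf; have [rE _] := params k perf.
  have gk0 : 0 < Num.sqrt (g k) by rewrite sqrtr_gt0 enorm_gt0; exact: perf.
  have rad0 : 0 < r k * Num.sqrt (g k) by rewrite mulr_gt0.
  have [d_lt|d_ge] := ltP (enorm (d k)) (r k * Num.sqrt (g k)).
    right; split; last exact: shrink.
    rewrite lerD2r (le_trans dec)// gerDl oppr_le0.
    by rewrite (mulr_ge0 (mulr_ge0 (ltW eta_gt0) (ltW rad0))) ?sqr_ge0.
  left; split=> //.
  have dE : enorm (d k) = r k * Num.sqrt (g k) by apply/eqP; rewrite eq_le d_le.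
  have r_min : rmin <= r k.
    rewrite rE; apply: r_ge; first exact: perf.
    by apply: a_le.
  have phi_cube : c * Num.sqrt (phi k) ^+ 3 <=
      eta * r k ^+ 3 * Num.sqrt (g k) ^+ 3.
    have -> : c * Num.sqrt (phi k) ^+ 3 =
        eta * rmin ^+ 3 * (Num.sqrt (phi k) ^+ 3 / Num.sqrt D ^+ 3).
      by rewrite /c mulrAC -mulrA.
    apply: ler_pM.
    - by rewrite mulr_ge0 ?exprn_ge0 ?(ltW eta_gt0) ?(ltW rmin0).
    - by rewrite divr_ge0 ?exprn_ge0 ?sqrtr_ge0.
    - by rewrite ler_wpM2l ?(ltW eta_gt0)// ler_pXn2r ?nnegrE// ltW.
    apply: (sqrtr_cubic_le D0 (ltW gk0)).
    rewrite sqr_sqrtr ?enorm_ge0//; apply: phi_le => j jk.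
    by apply: perf; exact: ltnW.
  have cube : eta * (r k * Num.sqrt (g k)) * enorm (d k) ^+ 2 =
      eta * r k ^+ 3 * Num.sqrt (g k) ^+ 3 by rewrite dE; ring.
  rewrite /phi addrAC lerD2r (le_trans dec)// lerD2l lerN2 cube.
  exact: phi_cube.
have gk0 : 0 < g 0%N by rewrite enorm_gt0.
have xi_golden := golden_ratio_bound xi_gt0 xi_le.
have [C C0 complexity] := mixed_step_complexity c0 D0 xi_gt0 xi_golden phi0 gk0.
exists C => // eps eps0 eps_le.
have [N [N_le small]] := complexity eps eps0 eps_le.
have [reach|[j jN [reach /stationary gj]]] := reached_or_stationary f x N.
  exists N; split=> //; apply: small; last exact: phi_le.
  by move=> k kN; apply: mixed; exact: reachP kN.
exists j; split=> //; last exact: le_trans gj (ltW eps0).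
by rewrite (le_trans _ N_le)// ler_nat ltnW.
Qed.
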